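(* Let $n_1,n_2,p,q,r$ be positive integers, and let $A_1\in\mathbb C^{n_1\times n_1}$, $B_1\in\mathbb C^{n_1\times q}$, $C_1\in\mathbb C^{p\times n_1}$, $D_1\in\mathbb C^{p\times q}$, $A_2\in\mathbb C^{n_2\times n_2}$, $B_2\in\mathbb C^{n_2\times r}$, $C_2\in\mathbb C^{q\times n_2}$, $D_2\in\mathbb C^{q\times r}$. Then for all $z_1,z_2\in\mathbb C$ such that $z_1$ is not an eigenvalue of $A_1$ and $z_2$ is not an eigenvalue of $A_2$, \[ \left(D_1+C_1(z_1I_{n_1}-A_1)^{-1}B_1\right)\left(D_2+C_2(z_2I_{n_2}-A_2)^{-1}B_2\right)=D+C(\Lambda(z)-A)^{-1}B, \] where \[ \Lambda(z)=\begin{pmatrix} z_1I_{n_1} & 0 \\ 0 & z_2I_{n_2} \end{pmatrix},\quad A=\begin{pmatrix} A_1 & B_1C_2 \\ 0 & A_2 \end{pmatrix},\quad B=\begin{pmatrix} B_1D_2 \\ B_2 \end{pmatrix},\quad C=\begin{pmatrix} C_1 & D_1C_2 \end{pmatrix},\quad D=D_1D_2 . \]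
   Context: $I_n$ denotes the $n\times n$ identity matrix. *)

(* Defs.v *)
From HB Require Import structures.
From mathcomp Require Import all_boot all_order all_algebra.
From mathcomp Require Import reals.
From mathcomp.real_closed Require Import complex.

Set Implicit Arguments.
Unset Strict Implicit.
Unset Printing Implicit Defensive.

(* Main.v *)
Require Import Defs.
From HB Require Import structures.
From mathcomp Require Import all_boot all_order all_algebra.
From mathcomp Require Import reals.
From mathcomp.real_closed Require Import complex.

Set Implicit Arguments.
Unset Strict Implicit.
Unset Printing Implicit Defensive.

Import Order.TTheory GRing.Theory Num.Theory.
Local Open Scope ring_scope.
Local Open Scope complex_scope.

(** Write [Ri] for the inverse of [zi I - Ai]. The matrix [Lambda - A] is block upper triangular, so
    its inverse has diagonal blocks [R1], [R2] and corner [R1 B1 C2 R2] ([invmx_ublock]). Between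
    [C] and [B] this yields [C1 R1 B1 D2], [C1 R1 B1 C2 R2 B2] and [D1 C2 R2 B2]; with [D1 D2] these
    are the four terms of the expanded product. The points [z1] and [z2] never interact. *)

Lemma ublock_mx_unit (K : comUnitRingType) n1 n2
    (M1 : 'M[K]_n1) (N : 'M[K]_(n1, n2)) (M2 : 'M[K]_n2) :
  (block_mx M1 N 0 M2 \in unitmx) = (M1 \in unitmx) && (M2 \in unitmx).
Proof. by rewrite !unitmxE det_ublock unitrM. Qed.

(** Multiplying the candidate by the block matrix gives the corner [- N M2^-1 + N M2^-1 = 0]. *)
Lemma invmx_ublock (K : comUnitRingType) n1 n2
    (M1 : 'M[K]_n1) (N : 'M[K]_(n1, n2)) (M2 : 'M[K]_n2) :
    M1 \in unitmx -> M2 \in unitmx ->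
  invmx (block_mx M1 N 0 M2)
  = block_mx (invmx M1) (- (invmx M1 *m N *m invmx M2)) 0 (invmx M2).
Proof.
move=> M1u M2u.
have Mu : block_mx M1 N 0 M2 \in unitmx by rewrite ublock_mx_unit M1u.
apply: (can_inj (mulKmx Mu)); rewrite mulmxV // mulmx_block.
rewrite !(mulmx0, mul0mx, addr0, add0r) !mulmxV // mulmxN !mulmxA mulmxV //.
by rewrite mul1mx addNr -scalar_mx_block.
Qed.

(** The eigenspace is the kernel of [A - z I], trivial exactly when this square matrix is
    invertible; the sign change is harmless. *)
Lemma resolvent_unitmx (F : fieldType) n (A : 'M[F]_n) z :
  (z%:M - A \in unitmx) = ~~ eigenvalue A z.
Proof.
rewrite /eigenvalue /eigenspace negbK kermx_eq0 row_free_unit.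
by rewrite -(opprB A) -scaleN1r unitmxZ // unitrN1.
Qed.

(** As [invmx] is total, the first conjunct certifies that [invmx (Lambda - A)] is a genuine
    inverse. *)
Theorem lemma2p3 (R : realType) (n1 n2 p q r : nat)
    (n1_gt0 : (0 < n1)%N) (n2_gt0 : (0 < n2)%N)
    (p_gt0 : (0 < p)%N) (q_gt0 : (0 < q)%N) (r_gt0 : (0 < r)%N)
    (A1 : 'M[R[i]]_n1) (B1 : 'M[R[i]]_(n1, q))
    (C1 : 'M[R[i]]_(p, n1)) (D1 : 'M[R[i]]_(p, q))
    (A2 : 'M[R[i]]_n2) (B2 : 'M[R[i]]_(n2, r))
    (C2 : 'M[R[i]]_(q, n2)) (D2 : 'M[R[i]]_(q, r))
    (z1 z2 : R[i])
    (z1_A1 : ~~ eigenvalue A1 z1) (z2_A2 : ~~ eigenvalue A2 z2) :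
  let Lambda : 'M[R[i]]_(n1 + n2) := block_mx z1%:M 0 0 z2%:M in
  let A : 'M[R[i]]_(n1 + n2) := block_mx A1 (B1 *m C2) 0 A2 in
  let B : 'M[R[i]]_(n1 + n2, r) := col_mx (B1 *m D2) B2 in
  let C : 'M[R[i]]_(p, n1 + n2) := row_mx C1 (D1 *m C2) in
  let D : 'M[R[i]]_(p, r) := D1 *m D2 in
  Lambda - A \in unitmx /\
  (D1 + C1 *m invmx (z1%:M - A1) *m B1) *m
    (D2 + C2 *m invmx (z2%:M - A2) *m B2)
  = D + C *m invmx (Lambda - A) *m B.
Proof.
move=> Lambda A B C D.
have M1u : z1%:M - A1 \in unitmx by rewrite resolvent_unitmx.
have M2u : z2%:M - A2 \in unitmx by rewrite resolvent_unitmx.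
have -> : Lambda - A
    = block_mx (z1%:M - A1) (- (B1 *m C2)) 0 (z2%:M - A2).
  by rewrite /Lambda /A opp_block_mx add_block_mx subr0 add0r.
split; first by rewrite ublock_mx_unit M1u.
(* The minus sign of the corner [- B1 C2] cancels the one in the inversion formula. *)
rewrite invmx_ublock // mulmxN mulNmx opprK /B /C /D.
rewrite mul_row_block mul_row_col mulmx0 addr0.
(* Both sides expand to the same four products, headed by [D1 D2]; the other three only need
   reordering. *)
rewrite !(mulmxDl, mulmxDr) !mulmxA -!addrA; congr (_ + _).
by rewrite [LHS]addrCA; congr (_ + _); rewrite addrC.
Qed.
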